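(* Let $N\ge1$, $B>0$, $\lambda_i>0$, $k_i>0$ ($i=1,\dots,N$), let $U_1,\dots,U_N:[0,1]\to\mathbb{R}$ be increasing, continuously differentiable and strictly concave, and let $C:\mathbb{R}\to\mathbb{R}$ be convex, increasing and differentiable. Set \[ W(\mathbf{h})=\sum_{i=1}^N U_i(h_i)-C\Bigl(\sum_{i=1}^N h_i-B\Bigr),\qquad \mathbf{h}\in[0,1]^N, \] let $\mathbf{h}^*$ be its unique maximizer on $[0,1]^N$, and assume $0<h_i^*<1$ for all $i$. Suppose that either $h_i=f_i(t_i)=1-\frac{1}{1+\lambda_it_i}$ for all $i$ (non-reset TTL cache), or $h_i=f_i(t_i)=1-e^{-\lambda_it_i}$ for all $i$ (reset TTL cache), where the timers $t_i\ge0$ evolve in time according to \[ \dot t_i=\begin{cases}k_i\bigl[U_i'(h_i)-C'\bigl(\sum_{j=1}^N h_j-B\bigr)\bigr], & t_i>0,\\ \max\bigl\{0,\,k_i\bigl[U_i'(h_i)-C'\bigl(\sum_{j=1}^N h_j-B\bigr)\bigr]\bigr\}, & t_i=0.\end{cases} \] Then $V(\mathbf{h})=W(\mathbf{h}^* )-W(\mathbf{h})$ is a Lyapunov function for this system: $V\ge0$, $V(\mathbf{h})=0$ only at $\mathbf{h}=\mathbf{h}^*$, and $\dot V<0$ along solutions whenever $\mathbf{h}\neq\mathbf{h}^*$. Moreover, from any initial condition, $\mathbf{h}$ converges to $\mathbf{h}^*$ as time tends to infinity.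
   Context: $h_i$ is the hit probability of file $i$ in a cache in which file $i$ has timer $t_i$ and Poisson request rate $\lambda_i$; $U_i$ is the utility of file $i$ and $C$ is the cost of using cache storage beyond $B$. The dynamics are the continuous-time version of the primal update $t_i\gets\max\{0,t_i+k_i[U_i'(h_i)-C'(\sum_j h_j-B)]\}$, where the current number of files in the cache is identified with $\sum_j h_j$. Solutions are absolutely continuous functions of time satisfying the differential equation for almost every time, and $\dot V$ is understood at such times. *)

(* Defs.v *)
From mathcomp Require Import all_boot all_order all_algebra.
From mathcomp Require Import all_classical all_reals all_analysis.
Export numFieldNormedType.Exports.

Set Implicit Arguments.
Unset Strict Implicit.
Unset Printing Implicit Defensive.
Import Order.TTheory GRing.Theory Num.Theory.

Local Open Scope classical_set_scope.
Local Open Scope ring_scope.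

(* One-sided at the endpoints of an interval [A], and insensitive to the values
   of [f] outside [A]: this is the derivative of a function [A -> R] that is
   represented by a total function. *)
Definition derivable_on (R : realType) (A : set R) (f : R -> R) (x : R) : Prop :=
  cvg ((y - x)^-1 * (f y - f x) @[y --> within A x^']).

Definition derive_on (R : realType) (A : set R) (f : R -> R) (x : R) : R :=
  lim ((y - x)^-1 * (f y - f x) @[y --> within A x^']).

Definition continuously_derivable_on (R : realType) (A : set R) (f : R -> R) :=
  (forall x, A x -> derivable_on A f x) /\ {within A, continuous (derive_on A f)}.

Definition strictly_concave_on (R : realType) (A : set R) (f : R -> R) :=
  forall (x y p : R), A x -> A y -> x != y -> 0 < p < 1 ->
    p * f x + (1 - p) * f y < f (p * x + (1 - p) * y).

Definition absolutely_continuous_on (R : realType) (a b : R) (f : R -> R) :=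
  forall e : R, 0 < e -> exists2 d : R, 0 < d &
    forall (n : nat) (u v : 'I_n -> R),
      (forall k, a <= u k /\ u k <= v k /\ v k <= b) ->
      trivIset [set: 'I_n] (fun k => `]u k, v k[%classic) ->
      \sum_(k < n) (v k - u k) < d ->
      \sum_(k < n) `|f (v k) - f (u k)| < e.

Variant ttl_cache := NonReset | Reset.

Definition hit_probability (R : realType) (c : ttl_cache) (lambda t : R) : R :=
  match c with
  | NonReset => 1 - 1 / (1 + lambda * t)
  | Reset => 1 - expR (- (lambda * t))
  end.

Definition hit_vector (R : realType) (N : nat) (c : ttl_cache)
    (lambda : 'I_N -> R) (t : 'rV[R]_N) : 'rV[R]_N :=
  \row_i hit_probability c (lambda i) (t 0 i).

Definition cube (R : realType) (N : nat) : set 'rV[R]_N :=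
  [set h | forall i, 0 <= h 0 i <= 1].

Definition net_utility (R : realType) (N : nat) (U : 'I_N -> R -> R)
    (C : R -> R) (B : R) (h : 'rV[R]_N) : R :=
  \sum_i U i (h 0 i) - C (\sum_i h 0 i - B).

Definition lyapunov (R : realType) (N : nat) (U : 'I_N -> R -> R)
    (C : R -> R) (B : R) (hstar h : 'rV[R]_N) : R :=
  net_utility U C B hstar - net_utility U C B h.

Definition timer_velocity (R : realType) (N : nat) (U : 'I_N -> R -> R)
    (C : R -> R) (B : R) (k : 'I_N -> R) (c : ttl_cache) (lambda : 'I_N -> R)
    (t : 'rV[R]_N) (i : 'I_N) : R :=
  let h := hit_vector c lambda t in
  let g := k i * (derive_on `[0, 1]%classic (U i) (h 0 i)
                  - derive1 C (\sum_j h 0 j - B)) in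
  if 0 < t 0 i then g else Num.max 0 g.

Definition satisfies_ode_at (R : realType) (N : nat) (U : 'I_N -> R -> R)
    (C : R -> R) (B : R) (k : 'I_N -> R) (c : ttl_cache) (lambda : 'I_N -> R)
    (t : R -> 'rV[R]_N) (s : R) : Prop :=
  forall i : 'I_N,
    is_derive s 1 (fun r => t r 0 i) (timer_velocity U C B k c lambda (t s) i).

(* Solution on the time interval [0, T[, where T may be +oo; the values of [t]
   outside this interval are irrelevant. *)
Definition solution (R : realType) (N : nat) (U : 'I_N -> R -> R)
    (C : R -> R) (B : R) (k : 'I_N -> R) (c : ttl_cache) (lambda : 'I_N -> R)
    (T : \bar R) (t : R -> 'rV[R]_N) : Prop :=
  [/\ forall (s : R) (i : 'I_N), 0 <= s -> (s%:E < T)%E -> 0 <= t s 0 i,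
      forall (b : R) (i : 'I_N), 0 <= b -> (b%:E < T)%E ->
        absolutely_continuous_on 0 b (fun s => t s 0 i)
    & {ae (@lebesgue_measure R), forall s : R, 0 < s -> (s%:E < T)%E ->
        satisfies_ode_at U C B k c lambda t s}].

(* Main.v *)
(** In the separable mobility of the dynamics, W has a second Lyapunov function
    besides V = W(h^* ) - W(h), namely
      D(t) = sum_i (F_i(t_i) - h^*_i t_i) / k_i,   where F_i' = f_i,
    which is bounded below on t >= 0. With m_i = U_i'(h_i) - C'(sum_j h_j - B),
      V' = - sum_i m_i f_i'(t_i) t_i' <= 0,
      D' = sum_i (h_i - h^*_i) t_i' / k_i <= sum_i (h_i - h^*_i) m_i <= - V,
    the last step by concavity of W. As V is nonincreasing, D(s) + V(b) s is
    nonincreasing on [0, b], so b V(b) <= D(0) - inf D and V tends to 0 at rate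
    1/b. This excludes the spurious equilibria h_i = 1 at infinite timers, where
    f_i' vanishes and V' alone gives no information. Finally V dominates each gap
    between U_i and its tangent at h^*_i, which is bounded away from 0 off every
    neighbourhood of h^*_i. *)

Require Import Defs.
From mathcomp Require Import all_boot all_order all_algebra.
From mathcomp Require Import all_classical all_reals all_analysis.
From mathcomp Require Import ring lra.
Import Order.TTheory GRing.Theory Num.Theory.
Local Open Scope classical_set_scope.
Local Open Scope ring_scope.

Set Implicit Arguments.
Unset Strict Implicit.
Unset Printing Implicit Defensive.

(* The derivative relative to [A], in a form that needs no case distinction at
   [y = x]. *)
Definition has_slope (R : realType) (A : set R) (f : R -> R) (x l : R) :=
  forall e : R, 0 < e -> exists2 d : R, 0 < d &
    forall y, A y -> `|y - x| < d -> `|f y - f x - l * (y - x)| <= e * `|y - x|.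

(** * Derivatives relative to a set, as first-order expansions *)

Section Slope.
Context {R : realType}.
Implicit Types (A : set R) (f h : R -> R) (x l m s : R).

Lemma has_slope_is_derive A f x l :
  nbhs x A -> has_slope A f x l -> is_derive x 1 f l.
Proof.
move=> Ax fl; apply/is_derive1_caratheodory.
(* Carathéodory's form: the difference quotient, filled in with [l] at [x], is continuous there. *)
exists (fun y => if y == x then l else (f y - f x) / (y - x)).
split; last by rewrite eqxx.
  move=> z; have [->|zx] := eqVneq z x; first by rewrite !subrr mulr0.
  by rewrite divfK// subr_eq0.
apply/cvgrPdist_le => /= e e0; rewrite eqxx.
have [d d0 H] := fl e e0.
near=> y; have [_|yx] := eqVneq y x; first by rewrite subrr normr0 ltW.
have yx0 : y - x != 0 by rewrite subr_eq0.
rewrite -(ler_pM2r (_ : 0 < `|y - x|)) ?normr_gt0// -normrM mulrBl divfK//.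
rewrite distrC; apply: H; first by near: y.
near: y; apply/nbhs_ballP; exists d => //= z; rewrite /ball/= distrC; exact.
Unshelve. all: by end_near. Qed.

Lemma is_derive_has_slope f x l : is_derive x 1 f l -> has_slope setT f x l.
Proof.
move=> /is_derive1_caratheodory[g [fg cg gl]] e e0.
move/cvgrPdist_le/(_ _ e0)/nbhs_ballP : cg => [d /= d0 H].
exists d => // y _ yx; rewrite fg -mulrBl normrM ler_wpM2r// -gl distrC.
by apply: H; rewrite /ball/= distrC.
Qed.

Lemma derive_on_has_slope A f x :
  derivable_on A f x -> has_slope A f x (derive_on A f x).
Proof.
move=> fx e e0.
have /cvgrPdist_le/(_ _ e0) : (y - x)^-1 * (f y - f x) @[y --> within A x^']
  --> derive_on A f x by exact: fx.
rewrite near_withinE => /nbhs_ballP[d /= d0 H].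
exists d => // y Ay yx; have [->|nyx] := eqVneq y x.
  by rewrite !subrr mulr0 subrr normr0 mulr0.
have yx0 : y - x != 0 by rewrite subr_eq0.
have := H y; rewrite /ball/= distrC => /(_ yx nyx Ay).
have -> : f y - f x - derive_on A f x * (y - x) =
    - ((derive_on A f x - (y - x)^-1 * (f y - f x)) * (y - x)) by field.
by rewrite normrN normrM; apply: ler_wpM2r.
Qed.

(** A chain rule for an outer function that is differentiable only relative to [A]. Since [h] stays
    in [A] near [s], the composite is still differentiable on both sides. This handles utilities at
    the endpoint 0 of their domain, where hit probabilities may lie. *)
Lemma has_slope_comp A f h s l m :
  has_slope A f (h s) l -> is_derive s 1 h m -> (\forall r \near s, A (h r)) ->
  is_derive s 1 (f \o h) (l * m).
Proof.
move=> fl hm Ah; apply: (has_slope_is_derive Ah) => e e0.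
pose e1 := e / (2 * (`|m| + 1)).
have e10 : 0 < e1 by rewrite divr_gt0// mulr_gt0// ltr_wpDl.
have [d1 d10 H1] := fl e1 e10.
(* The cap 1 makes [h] locally Lipschitz at [s] with constant [|m| + 1]; the other bound, like [e1],
   yields half of the error [e]. *)
pose e2 := Num.min 1 (e / (2 * (`|l| + 1))).
have e20 : 0 < e2.
  by rewrite lt_min ltr01 divr_gt0// mulr_gt0// ltr_wpDl.
have [d2 d20 H2] := is_derive_has_slope hm e20.
pose d := Num.min d2 (d1 / (`|m| + 1)).
have m1 : 0 < `|m| + 1 by rewrite ltr_wpDl.
have l1 : 0 < `|l| + 1 by rewrite ltr_wpDl.
exists d; first by rewrite lt_min d20 divr_gt0.
move=> y Ay; rewrite lt_min ltr_pdivlMr// => /andP[yd2 yd1].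
have {}H2 := H2 y I yd2.
have hle : `|h y - h s| <= (`|m| + 1) * `|y - s|.
  rewrite -(subrK (m * (y - s)) (h y - h s)) (le_trans (ler_normD _ _))//.
  rewrite normrM mulrDl mul1r addrC lerD2l (le_trans H2)//.
  by rewrite ler_piMl// ge_min lexx.
have {}H1 := H1 (h y) Ay (le_lt_trans hle _).
have {}H1 : `|f (h y) - f (h s) - l * (h y - h s)| <= e1 * `|h y - h s|.
  by apply: H1; rewrite mulrC.
rewrite /= (_ : _ - _ - _ = (f (h y) - f (h s) - l * (h y - h s)) +
  l * (h y - h s - m * (y - s))); last by ring.
rewrite (le_trans (ler_normD _ _))// (splitr e) mulrDl lerD//.
  apply: (le_trans H1); apply: (le_trans (ler_wpM2l (ltW e10) hle)).
  rewrite mulrA ler_wpM2r// /e1 [leLHS](_ : _ = e / 2)//; field.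
  by rewrite gt_eqF.
rewrite normrM; apply: (le_trans (ler_wpM2l (normr_ge0 _) H2)).
rewrite mulrA ler_wpM2r//.
apply: (@le_trans _ _ ((`|l| + 1) * (e / (2 * (`|l| + 1))))).
  by rewrite ler_pM// ?lerDl// ?(ltW e20)// ge_min lexx orbT.
rewrite [leLHS](_ : _ = e / 2)//; field.
by rewrite gt_eqF.
Qed.

Lemma is_derive_affine (k m x : R) : is_derive x 1 (fun y => k * y + m) k.
Proof.
apply: (@has_slope_is_derive setT); first exact: filterT.
move=> e e0; exists e => // y _ _.
by rewrite (_ : _ - _ = 0) ?normr0 ?mulr_ge0 ?(ltW e0)//; ring.
Qed.

End Slope.

(** Letting [u] and [v] straddle [x] allows real induction to jump across [x] in a single step. *)
Lemma is_derive_growth_le (R : realType) (f : R -> R) (x l e : R) :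
  is_derive x 1 f l -> l <= 0 -> 0 < e ->
  exists2 d, 0 < d & forall u v, u <= x -> x <= v ->
    `|u - x| < d -> `|v - x| < d -> f v - f u <= e * (v - u).
Proof.
move=> fl l0 e0; have [d d0 H] := is_derive_has_slope fl e0.
exists d => // u v ux xv ud vd.
have := H u I ud; have := H v I vd.
rewrite (ger0_norm (_ : 0 <= v - x)) ?subr_ge0//.
rewrite (ler0_norm (_ : u - x <= 0)) ?subr_le0//.
rewrite !ler_norml => /andP[_ Hv] /andP[Hu _].
have : l * (v - x) <= 0 by rewrite mulr_le0_ge0// subr_ge0.
have : 0 <= l * (u - x) by rewrite mulr_le0// subr_le0.
lra.
Qed.

(** * Monotonicity of absolutely continuous functions *)

Section Covering.
Context {R : realType}.
Variables (f : R -> R) (a e : R) (O : set R).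

(* Meant for an open [O] of small measure around the points where [f] may fail
   to have a nonpositive derivative: absolute continuity then makes the sum
   small. *)
Definition growth_controlled (x : R) :=
  exists n (u v : 'I_n -> R),
  [/\ forall k, a <= u k /\ u k <= v k /\ v k <= x,
      trivIset [set: 'I_n] (fun k => `]u k, v k[%classic),
      forall k, `]u k, v k[%classic `<=` O
    & f x - f a <= e * (x - a) + \sum_(k < n) `|f (v k) - f (u k)|].

Lemma growth_controlled_refl : growth_controlled a.
Proof.
exists 0%N, (fun=> 0), (fun=> 0); split; [by case|by move=> []|by case|].
by rewrite big_ord0 !subrr mulr0 addr0.
Qed.

Lemma growth_controlled_slope x y : growth_controlled x -> x <= y ->
  f y - f x <= e * (y - x) -> growth_controlled y.
Proof.
move=> [n [u [v [uv uvI uvO fx]]]] xy fxy; exists n, u, v; split => //.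
  by move=> k; have [? [? ?]] := uv k; split=> //; split=> //; lra.
lra.
Qed.

Lemma growth_controlled_open x y : 0 <= e -> a <= x ->
  growth_controlled x -> x <= y ->
  `]x, y[%classic `<=` O -> growth_controlled y.
Proof.
move=> e0 ax [n [u [v [uv uvI uvO fx]]]] xy xyO.
(* The new interval []x, y[] gets the last index, on which [unlift ord_max] returns [None]. *)
pose u' (k : 'I_n.+1) := oapp u x (unlift ord_max k).
pose v' (k : 'I_n.+1) := oapp v y (unlift ord_max k).
exists n.+1, u', v'; split.
- move=> k; rewrite /u' /v'; case: (unlift _ _) => [j|]/=; last by [].
  by have [? [? ?]] := uv j; split=> //; split=> //; lra.
- apply/trivIsetP => i j _ _ /=; rewrite /u' /v'.
  case: (unliftP ord_max i) => [i'|] ->; case: (unliftP ord_max j) => [j'|] -> /=.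
  + rewrite (inj_eq lift_inj) => ij.
    by move/trivIsetP : uvI => /(_ i' j' I I ij).
  + move=> _; rewrite -subset0 => z /=; rewrite !in_itv/=.
    by have [_ [_ ?]] := uv i'; lra.
  + move=> _; rewrite -subset0 => z /=; rewrite !in_itv/=.
    by have [_ [_ ?]] := uv j'; lra.
  + by rewrite eqxx.
- by move=> k; rewrite /u' /v'; case: (unlift _ _) => [j|]/=.
- rewrite big_ord_recr/= /u' /v' unlift_none/=.
  rewrite (eq_bigr (fun k => `|f (v k) - f (u k)|)); last first.
    move=> k _; rewrite (_ : widen_ord _ k = lift ord_max k) ?liftK//.
    by apply/val_inj => /=; rewrite /bump leqNgt ltn_ord.
  have := ler_norm (f y - f x); have : e * (x - a) <= e * (y - a).
    by rewrite ler_wpM2l// lerB.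
  lra.
Qed.

End Covering.

(** At the supremum [c] of the points satisfying [P], the step carries [P] from a point just left of
    [c], or [c] itself, to points beyond [c]. This contradicts the choice of [c] unless [b] is
    within reach. *)
Lemma real_induction (R : realType) (a b : R) (P : R -> Prop) : a <= b -> P a ->
  (forall c, a <= c <= b -> exists2 d, 0 < d &
    forall x y, a <= x -> P x -> c - d < x -> x <= c ->
      c <= y -> y < c + d -> y <= b -> P y) ->
  P b.
Proof.
move=> ab Pa step.
pose S := [set x | a <= x <= b /\ P x].
have supS : has_sup S.
  split; first by exists a; split; rewrite ?lexx.
  by exists b => x [/andP[]].
pose c := sup S.
have Sc x : S x -> x <= c by move=> Sx; apply: ub_le_sup => //; case: supS.
have cab : a <= c <= b.
  rewrite Sc ?lexx//; last by split; rewrite ?lexx.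
  by apply: ge_sup; [case: supS|move=> x [/andP[]]].
have [d d0 H] := step c cab.
have [x Sx cx] := sup_adherent d0 supS.
have [/andP[ax xb] Px] := Sx.
have Py y : c <= y -> y < c + d -> y <= b -> P y by exact: H (Sc _ Sx).
have [bc|bc] := ltP b (c + d); first by apply: Py => //; case/andP: cab.
have : S (c + d / 2).
  by split; [|apply: Py]; move/andP: cab => [? ?]; lra.
by move/Sc; lra.
Qed.

(** The null exceptional set lies in an open set [O] of measure below the [d] of absolute
    continuity. Real induction crosses exceptional points by intervals inside [O], whose total
    growth is below [e'], and all other points with slope at most [e']. *)
Lemma absolutely_continuous_nonincr (R : realType) (a b : R) (f : R -> R) :
  a <= b -> absolutely_continuous_on a b f ->
  {ae (@lebesgue_measure R), forall s, a < s < b ->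
    exists2 l, l <= 0 & is_derive s 1 f l} ->
  f b <= f a.
Proof.
move=> ab fac /= fae; apply/ler_addgt0Pr => e e0.
(* Chosen so that the slope part [e' * (b - a)] and the part over [O], below [e'], add up to at most
   [e]. *)
pose e' := e / (b - a + 2).
have e'0 : 0 < e' by rewrite divr_gt0//; lra.
have [d d0 Hd] := fac _ e'0.
(* The endpoints count as exceptional, so that every other point of the segment is interior and has
   a derivative. *)
pose E := [set s | ~ (a < s < b -> exists2 l, l <= 0 & is_derive s 1 f l)]
  `|` [set a; b].
pose mu : measure _ _ := @lebesgue_measure R.
have [D [mD D0 ED]] : mu.-negligible E.
  have n1 x : mu.-negligible [set x].
    by exists [set x]; split => //; exact: lebesgue_measure_set1.
  by do 2!apply: negligibleU => //.
have [||O [oO DO muO]] := @lebesgue_regularity_outer R D d mD.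
- by rewrite -/mu D0.
- by [].
have mO := measurable_realfun.open_measurable oO.
have {}muO : (mu O < d%:E)%E.
  rewrite -(setDUK DO); apply: le_lt_trans muO.
  apply: le_trans (measureU2 _ mD (measurableD mO mD)) _.
  by rewrite [X in (X + _)%E](_ : _ = 0%E) ?add0e; [|exact: D0].
have [n [u [v [uv uvI uvO fba]]]] : growth_controlled f a e' O b.
  apply: (@real_induction R a b) => //; first exact: growth_controlled_refl.
  move=> c /andP[ac cb]; have [cE|cE] := pselect (E c).
    have /nbhs_ballP[r /= r0 rO] : nbhs c O.
      by apply: open_nbhs_nbhs; split=> //; exact/DO/ED.
    exists r => // x y ax Px xc1 xc cy yc yb.
    apply: growth_controlled_open Px _ _ => //; [lra|lra|].
    move=> z /=; rewrite in_itv/= => zxy; apply: rO.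
    by rewrite /ball/= ltr_norml; lra.
  have acb : a < c < b.
    have ca : c != a by apply/eqP => ea; apply: cE; right; left.
    have cb' : c != b by apply/eqP => eb; apply: cE; right; right.
    by rewrite !lt_neqAle ac cb eq_sym ca cb'.
  have [l l0 fl] : exists2 l, l <= 0 & is_derive c 1 f l.
    by apply: contrapT => cP; apply: cE; left => /(_ acb).
  have [r r0 H] := is_derive_growth_le fl l0 e'0.
  exists r => // x y ax Px xc1 xc cy yc yb.
  apply: (growth_controlled_slope Px); first lra.
  by apply: H => //; rewrite ltr_norml; lra.
(* By disjointness the sum of the lengths is the measure of the union, which is contained in [O]. *)
have sum_lt : \sum_(k < n) (v k - u k) < d.
  rewrite -lte_fin; apply: le_lt_trans muO.
  rewrite -sumEFin (eq_bigr (fun k => mu `]u k, v k[%classic)).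
    rewrite -measure_bigsetU_ord_cond//.
    apply: le_measure; rewrite ?inE//; first exact: bigsetU_measurable.
    by apply: (big_ind (fun X => X `<=` O)) => // X Y XO YO z [/XO|/YO].
    have -> : (fun i : 'I_n => true) = [set: 'I_n] :> set 'I_n.
      by apply/funext => i; rewrite propeqE.
    exact: uvI.
  move=> k _; rewrite [RHS](@lebesgue_measure_itv R `]u k, v k[) /= lte_fin.
  have [_ [+ _]] := uv k; rewrite le_eqVlt => /predU1P[->|->//].
  by rewrite ltxx subrr.
have := Hd n u v uv uvI sum_lt.
have : e' * (b - a) + e' <= e.
  rewrite -{2}(mulr1 e') -mulrDr /e' -mulrA ler_piMr//; first lra.
  by rewrite mulrC ler_pdivrMr; lra.
lra.
Qed.

(** * Closure properties of absolute continuity *)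

Section AbsoluteContinuity.
Context {R : realType}.
Implicit Types (a b K : R) (f g : R -> R).

Lemma absolutely_continuous_dominated a b K f g : 0 <= K ->
  absolutely_continuous_on a b g ->
  (forall u v, a <= u -> u <= v -> v <= b -> `|f v - f u| <= K * `|g v - g u|) ->
  absolutely_continuous_on a b f.
Proof.
move=> K0 gac fg e e0.
have K1 : 0 < K + 1 by lra.
have [d d0 H] := gac (e / (K + 1)) (divr_gt0 e0 K1).
exists d => // n u v uv uvI /(H n u v uv uvI); rewrite ltr_pdivlMr//.
apply: le_lt_trans; rewrite mulr_suml; apply: ler_sum => k _.
have [au [ukv vb]] := uv k; apply: le_trans (fg _ _ au ukv vb) _.
by rewrite mulrC ler_wpM2l// lerDl.
Qed.

Lemma absolutely_continuous_id a b : absolutely_continuous_on a b id.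
Proof.
move=> e e0; exists e => // n u v uv _; rewrite (eq_bigr (fun k => `|v k - u k|))//.
by move=> k _; rewrite ger0_norm// subr_ge0; have [_ []] := uv k.
Qed.

Lemma absolutely_continuousD a b f g :
  absolutely_continuous_on a b f -> absolutely_continuous_on a b g ->
  absolutely_continuous_on a b (fun x => f x + g x).
Proof.
move=> fac gac e e0.
have e20 : 0 < e / 2 by lra.
have [d d0 H] := fac _ e20; have [d' d'0 H'] := gac _ e20.
exists (Num.min d d'); first by rewrite lt_min d0.
move=> n u v uv uvI;
  rewrite lt_min => /andP[/(H n u v uv uvI) s1 /(H' n u v uv uvI) s2].
rewrite (splitr e); apply: le_lt_trans (ltrD s1 s2).
rewrite -big_split/=; apply: ler_sum => k _.
by rewrite (_ : _ - _ = f (v k) - f (u k) + (g (v k) - g (u k)))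
  ?ler_normD//; ring.
Qed.

Lemma absolutely_continuous_sum a b n (f : 'I_n -> R -> R) :
  (forall i, absolutely_continuous_on a b (f i)) ->
  absolutely_continuous_on a b (fun x => \sum_i f i x).
Proof.
elim: n f => [|n IHn] f fac.
  apply: (@absolutely_continuous_dominated _ _ 0 _ id) => //.
    exact: absolutely_continuous_id.
  by move=> u v _ _ _; rewrite !big_ord0 subrr normr0 mul0r.
rewrite [X in absolutely_continuous_on _ _ X](_ : _ =
    fun x => f ord0 x + \sum_i f (lift ord0 i) x); last first.
  by apply/funext => x; rewrite big_ord_recl.
by apply: absolutely_continuousD => //; exact: IHn.
Qed.

End AbsoluteContinuity.

(** * Tangents of concave and convex functions *)

Section Concavity.
Context {R : realType}.

(** Compare the chord with the expansion of [f] at [x + p (y - x)], divide by [p] and let the error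
    vanish. Concavity is asked only along the segment from [x] to [y], so the lemma serves both
    utilities on [0, 1] and the cost on the whole line. *)
Lemma has_slope_tangent (A : set R) (f : R -> R) (x y l : R) :
  has_slope A f x l ->
  (forall p, 0 < p < 1 -> A (p * y + (1 - p) * x) /\
    p * f y + (1 - p) * f x <= f (p * y + (1 - p) * x)) ->
  f y <= f x + l * (y - x).
Proof.
move=> fl fconc; apply/ler_addgt0Pr => e e0.
pose D := `|y - x| + 1.
have D0 : 0 < D by rewrite ltr_wpDl.
have [d d0 H] := fl (e / D) (divr_gt0 e0 D0).
(* The first bound keeps [p] below 1; the second puts the point at distance less than [d] from
   [x]. *)
pose p := Num.min (1 / 2) (d / (2 * D)).
have p0 : 0 < p by rewrite lt_min !divr_gt0// mulr_gt0.
have p1 : p < 1 by rewrite gt_min; apply/orP; left; lra.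
have [Az fz] := fconc p (introT andP (conj p0 p1)).
have zx : p * y + (1 - p) * x - x = p * (y - x) by ring.
have pD : p * D < d.
  have : p <= d / (2 * D) by rewrite ge_min lexx orbT.
  rewrite -(ler_pM2r D0) (_ : d / (2 * D) * D = d / 2); last by field; rewrite gt_eqF.
  lra.
have := H _ Az; rewrite zx normrM gtr0_norm//.
have yxD : `|y - x| <= D by rewrite lerDl.
move=> /(_ (le_lt_trans (ler_wpM2l (ltW p0) yxD) pD)).
rewrite ler_norml => /andP[_].
have : e / D * (p * `|y - x|) <= p * e.
  rewrite mulrCA ler_wpM2l ?(ltW p0)// mulrAC -mulrA ler_piMr ?(ltW e0)//.
  by rewrite ler_pdivrMr// mul1r.
by move=> h1 h2; rewrite -(ler_pM2l p0); lra.
Qed.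

(** The tangent inequalities at two points force [d] to be nonincreasing, so all slopes lie between
    [d hi] and [d lo]. *)
Lemma tangent_lipschitz (f d : R -> R) (lo hi : R) :
  (forall x y, lo <= x <= hi -> lo <= y <= hi -> f y <= f x + d x * (y - x)) ->
  forall x y, lo <= x <= hi -> lo <= y <= hi ->
    `|f y - f x| <= (`|d lo| + `|d hi|) * `|y - x|.
Proof.
move=> T.
have dmono x y : lo <= x <= hi -> lo <= y <= hi -> x <= y -> d y <= d x.
  move=> xi yi; rewrite le_eqVlt => /predU1P[->//|xy].
  have T1 := T x y xi yi; have T2 := T y x yi xi.
  by rewrite -(ler_pM2r (_ : 0 < y - x)); lra.
move=> x y; wlog xy : x y / x <= y.
  move=> H xi yi; have [/H|/ltW/H] := leP x y; first exact.
  by rewrite distrC (distrC x y); exact.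
move=> xi yi; rewrite (ger0_norm (_ : 0 <= y - x)) ?subr_ge0//.
have loi : lo <= lo <= hi by case/andP: xi => *; lra.
have hii : lo <= hi <= hi by case/andP: xi => *; lra.
have dx : d x <= d lo by apply: dmono => //; case/andP: xi.
have dy : d hi <= d y by apply: dmono => //; case/andP: yi.
have dx' := le_trans dx (ler_norm _).
have dy' : - `|d hi| <= d y by apply: le_trans dy; rewrite lerNl -normrN ler_norm.
have yx0 : 0 <= y - x by lra.
rewrite ler_norml; apply/andP; split.
  have := T y x yi xi; have := ler_wpM2r yx0 dy'.
  have : 0 <= `|d lo| * (y - x) by rewrite mulr_ge0.
  lra.
have := T x y xi yi; have := ler_wpM2r yx0 dx'.
have : 0 <= `|d hi| * (y - x) by rewrite mulr_ge0.
lra.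
Qed.

End Concavity.

Section ConcaveUtility.
Context {R : realType} (f : R -> R).
Hypothesis f_diff : forall x, `[0, 1]%classic x -> derivable_on `[0, 1]%classic f x.
Hypothesis f_conc : strictly_concave_on `[0, 1]%classic f.
Let df := derive_on `[0, 1]%classic f.

Lemma concave_tangent (x y : R) : 0 <= x <= 1 -> 0 <= y <= 1 ->
  f y <= f x + df x * (y - x).
Proof.
move=> xi yi.
have Sx : `[0, 1]%classic x by rewrite /= in_itv.
have Sy : `[0, 1]%classic y by rewrite /= in_itv.
have [->|yx] := eqVneq y x; first by rewrite subrr mulr0 addr0.
apply: (has_slope_tangent (derive_on_has_slope (f_diff Sx))) => p pi.
split; last by apply: ltW; exact: f_conc.
by rewrite /= in_itv/=; nra.
Qed.

(** At the midpoint [f] is strictly above the chord and still below the tangent at [x]; this makes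
    the inequality at [y] strict. *)
Lemma strictly_concave_tangent (x y : R) : 0 <= x <= 1 -> 0 <= y <= 1 -> y != x ->
  f y < f x + df x * (y - x).
Proof.
move=> xi yi yx.
have := @concave_tangent x (2^-1 * y + (1 - 2^-1) * x) xi.
have := @f_conc y x 2^-1; rewrite /= !in_itv/= => /(_ yi xi yx).
have h : 0 < (2^-1 : R) < 1 by lra.
move=> /(_ h) + /(_ ltac:(lra)); lra.
Qed.

End ConcaveUtility.

Lemma convex_tangent (R : realType) (C : R -> R) (x y : R) :
  convex_function [set: R^o] C -> derivable C x 1 ->
  C x + derive1 C x * (y - x) <= C y.
Proof.
move=> Cconv Cx.
have Cd : is_derive x 1 C (derive1 C x) by rewrite derive1E; exact/derivableP.
(* The concave case is applied to [- C]. *)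
have := @has_slope_tangent R setT (\- C) x y (- derive1 C x).
have /is_derive_has_slope CN : is_derive x 1 (\- C) (- derive1 C x) by
  exact: is_deriveN.
move=> /(_ CN);
  suff H : forall p : R, 0 < p < 1 -> [set: R] (p * y + (1 - p) * x) /\
    p * (\- C) y + (1 - p) * (\- C) x <= (\- C) (p * y + (1 - p) * x).
  by move=> /(_ H) /=; lra.
move=> p /andP[p0 p1]; split => //=.
have p01 : Itv.spec (@Itv.num_sem R) (Itv.Real `[0%Z, 1%Z]) p.
  by apply/andP; rewrite num_real/= in_itv/= !ltW.
have := Cconv (Itv.mk p01) y x; rewrite !inE => /(_ I I).
by rewrite !convRE/= /unstable.onem; lra.
Qed.

(** * Hit probabilities *)

Section HitProbability.
Context {R : realType}.
Implicit Types (c : ttl_cache) (lam t p : R).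

Definition hit_rate c lam t : R :=
  match c with
  | NonReset => lam / (1 + lam * t) ^+ 2
  | Reset => lam * expR (- (lam * t))
  end.

(** An antiderivative of the hit probability in the timer, the F_i of the second Lyapunov
    function. *)
Definition hit_primitive c lam t : R :=
  match c with
  | NonReset => t - ln (1 + lam * t) / lam
  | Reset => t + expR (- (lam * t)) / lam
  end.

Lemma hit_probability0 c lam : hit_probability c lam 0 = 0.
Proof.
by case: c; rewrite /= mulr0 ?oppr0 ?expR0 ?addr0 ?divr1 subrr.
Qed.

Lemma hit_probability_bounds c lam t : 0 < lam -> 0 <= t ->
  0 <= hit_probability c lam t < 1.
Proof.
move=> l0 t0; have lt0 : 0 <= lam * t by rewrite mulr_ge0// ltW.
case: c => /=.
  have d0 : 0 < 1 + lam * t by lra.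
  have : 1 / (1 + lam * t) <= 1 by rewrite ler_pdivrMr//; lra.
  have : 0 < 1 / (1 + lam * t) by rewrite divr_gt0.
  lra.
have := expR_gt0 (- (lam * t)).
have : expR (- (lam * t)) <= 1 by rewrite -expR0 ler_expR; lra.
lra.
Qed.

Lemma hit_rate_bounds c lam t : 0 < lam -> 0 <= t -> 0 < hit_rate c lam t <= lam.
Proof.
move=> l0 t0; have lt0 : 0 <= lam * t by rewrite mulr_ge0// ltW.
case: c => /=; apply/andP; split.
- by rewrite divr_gt0// exprn_gt0//; lra.
- have d1 : 1 <= 1 + lam * t by lra.
  have d2 : 1 <= (1 + lam * t) ^+ 2 by apply: exprn_ege1.
  by rewrite ler_pdivrMr ?(lt_le_trans _ d2)// ler_peMr// ltW.
- by rewrite mulr_gt0// expR_gt0.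
- by rewrite ler_piMr ?(ltW l0)// -expR0 ler_expR; lra.
Qed.

Lemma is_derive_hit_probability c lam t : 0 < lam -> 0 <= t ->
  is_derive t 1 (hit_probability c lam) (hit_rate c lam t).
Proof.
move=> l0 t0; have lt0 : 0 <= lam * t by rewrite mulr_ge0// ltW.
case: c => /=.
  have d0 : 1 + lam * t != 0 by lra.
  have aff : is_derive t 1 (fun t => lam * t + 1) lam := is_derive_affine lam 1 t.
  have aff0 : lam * t + 1 != 0 by rewrite addrC.
  rewrite (_ : hit_probability NonReset lam = cst 1 - (fun t => (lam * t + 1)^-1)).
    have ? := @is_deriveV R (fun t => lam * t + 1) t lam 1 aff0 aff.
    apply: is_derive_eq; rewrite sub0r /GRing.scale/=; field.
    by [].
  by apply/funext => z; rewrite !fctE /= div1r (addrC 1 (lam * z)).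
rewrite (_ : hit_probability Reset lam = cst 1 - (expR \o (fun t => - lam * t + 0))).
  have ? := is_derive1_comp (is_derive_expR _) (is_derive_affine (- lam) 0 t).
  by apply: is_derive_eq; rewrite addr0 (mulNr lam t); ring.
by apply/funext => z; rewrite !fctE /= addr0 mulNr.
Qed.

Lemma is_derive_hit_primitive c lam t : 0 < lam -> 0 <= t ->
  is_derive t 1 (hit_primitive c lam) (hit_probability c lam t).
Proof.
move=> l0 t0; have lt0 : 0 <= lam * t by rewrite mulr_ge0// ltW.
case: c => /=.
  have d0 : 0 < lam * t + 1 by lra.
  rewrite (_ : hit_primitive NonReset lam = id - lam^-1 \*: (@ln R \o (fun t => lam * t + 1))).
    have ? := @is_derive1_comp R (@ln R) (fun t => lam * t + 1) t _ _
      (is_derive1_ln d0) (is_derive_affine lam 1 t).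
    apply: is_derive_eq; rewrite /GRing.scale/=; field.
    by rewrite (addrC 1) !gt_eqF.
  by apply/funext => z; rewrite !fctE/= /GRing.scale/= mulrC (addrC 1).
rewrite (_ : hit_primitive Reset lam = id + lam^-1 \*: (expR \o (fun t => - lam * t + 0))).
  have ? := is_derive1_comp (is_derive_expR _) (is_derive_affine (- lam) 0 t).
  apply: is_derive_eq; rewrite /GRing.scale/= addr0 mulNr; field.
  by rewrite gt_eqF.
by apply/funext => z; rewrite !fctE/= /GRing.scale/= mulrC addr0 mulNr.
Qed.

Lemma derive_bounded_lipschitz (f df : R -> R) (K : R) :
  (forall x : R, 0 <= x -> is_derive x 1 f (df x)) ->
  (forall x, 0 <= x -> `|df x| <= K) ->
  forall x y, 0 <= x -> 0 <= y -> `|f y - f x| <= K * `|y - x|.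
Proof.
move=> fd dK x y; wlog xy : x y / x <= y.
  move=> H x0 y0; have [/H|/ltW/H] := leP x y; first exact.
  by rewrite distrC (distrC x y); exact.
move=> x0 y0; have [||z zi ->] := @MVT_segment R f df x y xy.
- by move=> z; rewrite in_itv/= => zi; apply: fd; lra.
- apply: derivable_within_continuous => z; rewrite in_itv/= => zi.
  by have [] := fd z ltac:(lra).
by rewrite normrM ler_wpM2r// dK//; move: zi; rewrite in_itv/=; lra.
Qed.

(** The hit probability tends to 1 > [p], so the difference eventually increases. With [p] the
    optimal hit probability, this bounds the second Lyapunov function from below. *)
Lemma hit_primitive_ge c lam p : 0 < lam -> 0 < p < 1 ->
  exists m, forall t, 0 <= t -> m <= hit_primitive c lam t - p * t.
Proof.
move=> l0 /andP[p0 p1]; have q0 : 0 < 1 - p by lra.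
case: c => /=.
  (* This is the minimum, attained where the hit probability equals [p]. It comes from ln z <= z - 1
     at z = [(1 - p) * (1 + lam * t)]. *)
  exists ((p + ln (1 - p)) / lam) => t t0.
  have lt0 : 0 <= lam * t by rewrite mulr_ge0// ltW.
  have := @le_ln1Dx R ((1 - p) * (1 + lam * t) - 1).
  rewrite (_ : 1 + ((1 - p) * (1 + lam * t) - 1) = (1 - p) * (1 + lam * t));
    last by ring.
  rewrite lnM ?posrE//; last lra.
  have : 0 < (1 - p) * (1 + lam * t) by rewrite mulr_gt0//; lra.
  move=> h /(_ ltac:(lra)) H.
  rewrite ler_pdivrMr// !mulrBl divfK ?gt_eqF//; lra.
exists 0 => t t0.
have : 0 <= expR (- (lam * t)) / lam by rewrite divr_ge0 ?expR_ge0// ltW.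
have : 0 <= (1 - p) * t by rewrite mulr_ge0// ltW.
lra.
Qed.

End HitProbability.

Lemma is_derive_fsum (R : realType) n (f : 'I_n -> R -> R) (x : R) (d : 'I_n -> R) :
  (forall i, is_derive x 1 (f i) (d i)) ->
  is_derive x 1 (fun r => \sum_i f i r) (\sum_i d i).
Proof. by move=> fd; rewrite -fct_sumE; exact: is_derive_sum. Qed.

(** * The gap between a concave function and its tangent *)

Section ConcaveGap.
Context {R : realType} (f d : R -> R).
Hypothesis tangent : forall x y, 0 <= x <= 1 -> 0 <= y <= 1 ->
  f y <= f x + d x * (y - x).

(** With [d] the derivative of [f], this is the Bregman divergence of [- f]. *)
Definition tangent_gap (x0 x : R) := f x0 + d x0 * (x - x0) - f x.

(** The gap grows away from [x0] on either side, because its slope [d x0 - d z] has the sign of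
    [z - x0]. *)
Lemma tangent_gap_le x0 z x : 0 <= x0 <= 1 -> 0 <= z <= 1 -> 0 <= x <= 1 ->
  x0 < z <= x \/ x <= z < x0 -> tangent_gap x0 z <= tangent_gap x0 x.
Proof.
move=> x0i zi xi zx; rewrite /tangent_gap.
have T1 := tangent x0i zi; have T2 := tangent zi x0i; have T3 := tangent zi xi.
suff : (d z - d x0) * (x - z) <= 0 by lra.
case: zx => /andP[h1 h2].
  rewrite mulr_le0_ge0//; last lra.
  by rewrite -(ler_pM2r (_ : 0 < z - x0)); lra.
rewrite mulr_ge0_le0//; last lra.
by rewrite -(ler_pM2r (_ : 0 < x0 - z)); lra.
Qed.

Lemma tangent_gap_separated x0 e : 0 < x0 < 1 -> 0 < e ->
  (forall y, 0 <= y <= 1 -> y != x0 -> f y < f x0 + d x0 * (y - x0)) ->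
  exists2 m, 0 < m & forall x, 0 <= x <= 1 -> tangent_gap x0 x < m -> `|x0 - x| < e.
Proof.
move=> /andP[x00 x01] e0 strict.
(* Both [x0 - r] and [x0 + r] lie in [0, 1] and within [e] of [x0]. By monotonicity the gap at
   distance [e] or more is at least the smaller of the gaps at these two points. *)
pose r := Num.min (e / 2) (Num.min x0 (1 - x0)).
have r0 : 0 < r by rewrite !lt_min; lra.
have re : r < e by rewrite gt_min; apply/orP; left; lra.
have rx0 : r <= x0 by rewrite !ge_min lexx !orbT.
have r1x0 : r <= 1 - x0 by rewrite !ge_min lexx !orbT.
have gap_gt0 y : 0 <= y <= 1 -> y != x0 -> 0 < tangent_gap x0 y.
  by move=> yi /(strict _ yi); rewrite /tangent_gap; lra.
exists (Num.min (tangent_gap x0 (x0 + r)) (tangent_gap x0 (x0 - r))).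
  by rewrite lt_min !gap_gt0//; lra.
move=> x xi; rewrite lt_min => /andP[g1 g2]; rewrite ltNge; apply/negP => ex.
have [xx0|xx0] := leP x0 x.
  move: g1; rewrite ltNge => /negP; apply; apply: tangent_gap_le; try lra.
  by left; move: ex; rewrite ler0_norm; lra.
move: g2; rewrite ltNge => /negP; apply; apply: tangent_gap_le; try lra.
by right; move: ex; rewrite ger0_norm; lra.
Qed.

End ConcaveGap.

(** * The net utility and its maximizer *)

Section Model.
Context {R : realType} {N : nat}.
Variables (B : R) (lambda k : 'I_N -> R) (U : 'I_N -> R -> R) (C : R -> R).
Variables (hstar : 'rV[R]_N) (c : ttl_cache).
Hypothesis lambda_gt0 : forall i, 0 < lambda i.
Hypothesis k_gt0 : forall i, 0 < k i.
Hypothesis U_diff : forall i x, `[0, 1]%classic x ->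
  derivable_on `[0, 1]%classic (U i) x.
Hypothesis U_concave : forall i, strictly_concave_on `[0, 1]%classic (U i).
Hypothesis C_convex : convex_function [set: R^o] C.
Hypothesis C_derivable : forall x, derivable C x 1.
Hypothesis hstar_cube : cube hstar.
Hypothesis hstar_max :
  forall h, cube h -> net_utility U C B h <= net_utility U C B hstar.
Hypothesis hstar_interior : forall i, 0 < hstar 0 i < 1.

Let dU i := derive_on `[0, 1]%classic (U i).

Definition marginal (h : 'rV[R]_N) i :=
  dU i (h 0 i) - derive1 C (\sum_j h 0 j - B).

Lemma U_tangent i x y : 0 <= x <= 1 -> 0 <= y <= 1 ->
  U i y <= U i x + dU i x * (y - x).
Proof. by move=> xi yi; apply: concave_tangent => // z; exact: U_diff. Qed.

Lemma C_is_derive (x : R) : is_derive x 1 C (derive1 C x).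
Proof. by rewrite derive1E; exact/derivableP. Qed.

(** The supporting hyperplane of the concave W, whose gradient is [marginal]: the tangent
    inequalities of the utilities and of the cost are added. *)
Lemma net_utility_tangent h h' : cube h -> cube h' ->
  net_utility U C B h' <=
  net_utility U C B h + \sum_i marginal h i * (h' 0 i - h 0 i).
Proof.
move=> hc h'c; rewrite /net_utility.
have -> : \sum_i marginal h i * (h' 0 i - h 0 i) =
    \sum_i dU i (h 0 i) * (h' 0 i - h 0 i) -
    derive1 C (\sum_j h 0 j - B) * (\sum_i h' 0 i - \sum_i h 0 i).
  rewrite -[in X in _ = _ - _ * X]sumrB mulr_sumr -sumrB.
  by apply: eq_bigr => i _; rewrite /marginal mulrBl.
have := @convex_tangent R C (\sum_i h 0 i - B) (\sum_i h' 0 i - B) C_convex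
  (@C_derivable _).
have : \sum_i U i (h' 0 i) <=
    \sum_i U i (h 0 i) + \sum_i dU i (h 0 i) * (h' 0 i - h 0 i).
  rewrite -big_split/=; apply: ler_sum => i _; exact: U_tangent.
lra.
Qed.

(** Fermat's rule for W along the i-th coordinate, at a maximizer interior to [0, 1]. *)
Lemma marginal_hstar i : marginal hstar i = 0.
Proof.
pose h x : 'rV[R]_N := \row_j if j == i then x else hstar 0 j.
have hsum x : \sum_j h x 0 j = x + \sum_(j | j != i) hstar 0 j.
  rewrite (bigD1 i)//= mxE eqxx; congr (_ + _).
  by apply: eq_bigr => j /negbTE ji; rewrite mxE ji.
have hstarE : h (hstar 0 i) = hstar.
  by apply/rowP => j; rewrite mxE; case: eqP => [->|].
pose a := \sum_(j | j != i) hstar 0 j - B.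
(* The factor 1 gives the inner function the shape of [is_derive_affine]. *)
pose phi x := U i x - C (1 * x + a).
have phi_derive (x : R) : 0 < x < 1 ->
    is_derive x 1 phi (dU i x - derive1 C (1 * x + a)).
  move=> xi; apply: is_deriveB.
    have Sx : `[0, 1]%classic x by rewrite /= in_itv/=; lra.
    apply: has_slope_is_derive (derive_on_has_slope (@U_diff i x Sx)).
    have : x \in `]0, 1[ by rewrite in_itv.
    move=> /near_in_itvoo; apply: filterS => y /=; rewrite !in_itv/=; lra.
  rewrite -[X in is_derive _ _ _ X]mulr1.
  exact: (@is_derive1_comp R C (fun x => 1 * x + a) x _ _
    (C_is_derive _) (is_derive_affine 1 a x)).
have netE x : net_utility U C B (h x) =
    phi x + \sum_(j | j != i) U j (hstar 0 j).
  rewrite /net_utility hsum (bigD1 i)//= mxE eqxx /phi mul1r /a addrA.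
  rewrite (eq_bigr (fun j => U j (hstar 0 j))); first by ring.
  by move=> j /negbTE ji; rewrite mxE ji.
have D0 : is_derive (hstar 0 i) 1 phi 0.
  apply: (@derive1_at_max R phi 0 1) => //.
  - move=> t; rewrite in_itv/= => ti; apply: ex_derive; exact: phi_derive.
  - by rewrite in_itv/= hstar_interior.
  - move=> t; rewrite in_itv/= => ti.
    have : cube (h t).
      by move=> j; rewrite mxE; case: eqP => [_|_]; [lra|exact: hstar_cube].
    have := netE (hstar 0 i); rewrite hstarE => netstar.
    by move/hstar_max; rewrite netE netstar; lra.
have D1 := phi_derive _ (hstar_interior i).
rewrite /marginal.
have -> : \sum_j hstar 0 j - B = 1 * hstar 0 i + a.
  by rewrite -[in LHS]hstarE hsum mul1r /a addrA.
by rewrite -(@derive_val _ _ _ _ _ _ _ D1) (@derive_val _ _ _ _ _ _ _ D0).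
Qed.

Lemma lyapunov_le_marginal h : cube h ->
  lyapunov U C B hstar h <= \sum_i marginal h i * (hstar 0 i - h 0 i).
Proof.
by move=> hc; have := net_utility_tangent hc hstar_cube; rewrite /lyapunov; lra.
Qed.

Lemma tangent_gap_ge0 i x : 0 <= x <= 1 ->
  0 <= tangent_gap (U i) (dU i) (hstar 0 i) x.
Proof.
by move=> xi; have := U_tangent i (hstar_cube i) xi; rewrite /tangent_gap; lra.
Qed.

(** The marginals vanish at the maximizer, so the linear terms cancel and V is the sum of all
    tangent gaps of the utilities plus the convexity gap of [C]. All of these are nonnegative. *)
Lemma tangent_gap_le_lyapunov h i : cube h ->
  tangent_gap (U i) (dU i) (hstar 0 i) (h 0 i) <= lyapunov U C B hstar h.
Proof.
move=> hc.
apply: (@le_trans _ _ (\sum_j tangent_gap (U j) (dU j) (hstar 0 j) (h 0 j))).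
  rewrite (bigD1 i)//= lerDl; apply: sumr_ge0 => j _.
  exact/tangent_gap_ge0/hc.
have -> : \sum_j tangent_gap (U j) (dU j) (hstar 0 j) (h 0 j) =
   \sum_j U j (hstar 0 j) - \sum_j U j (h 0 j) +
    derive1 C (\sum_j hstar 0 j - B) * (\sum_i h 0 i - \sum_i hstar 0 i).
  rewrite -[in X in _ = _ + _ * X]sumrB mulr_sumr -sumrB -big_split/=.
  apply: eq_bigr => j _; rewrite /tangent_gap.
  have /eqP := marginal_hstar j; rewrite /marginal subr_eq0 => /eqP ->; ring.
rewrite /lyapunov /net_utility.
have := @convex_tangent R C (\sum_i hstar 0 i - B) (\sum_i h 0 i - B) C_convex
  (@C_derivable _).
lra.
Qed.

Lemma lyapunov_ge0 h : cube h -> 0 <= lyapunov U C B hstar h.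
Proof. by move=> hc; rewrite subr_ge0 hstar_max. Qed.

Lemma U_strict i y : 0 <= y <= 1 -> y != hstar 0 i ->
  U i y < U i (hstar 0 i) + dU i (hstar 0 i) * (y - hstar 0 i).
Proof.
by move=> yi yh; apply: strictly_concave_tangent => // z; exact: U_diff.
Qed.

Lemma lyapunov_eq0 h : cube h -> lyapunov U C B hstar h <= 0 -> h = hstar.
Proof.
move=> hc V0; apply/rowP => i; apply/eqP/negP => /negP hi.
have := tangent_gap_le_lyapunov i hc; have := U_strict (hc i) hi.
rewrite /tangent_gap; lra.
Qed.

Lemma lyapunov_separated (e : R) i : 0 < e -> exists2 m, 0 < m &
  forall h, cube h -> lyapunov U C B hstar h < m -> `|hstar 0 i - h 0 i| < e.
Proof.
move=> e0.
have [m m0 H] := tangent_gap_separated (U_tangent i) (hstar_interior i) e0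
  (@U_strict i).
exists m => // h hc Vm; apply: H; first exact: hc.
exact: le_lt_trans (tangent_gap_le_lyapunov i hc) Vm.
Qed.

(** * Trajectories *)

(** The time derivative of V given by the chain rule, as a function of the timers alone. *)
Definition lyapunov_slope (x : 'rV[R]_N) : R :=
  - \sum_i marginal (hit_vector c lambda x) i *
      (hit_rate c (lambda i) (x 0 i) * timer_velocity U C B k c lambda x i).

Section Trajectory.
Variables (T : \bar R) (t : R -> 'rV[R]_N).
Hypothesis t_sol : solution U C B k c lambda T t.

Let h s := hit_vector c lambda (t s).
Let V s := lyapunov U C B hstar (h s).
Let velocity s i := timer_velocity U C B k c lambda (t s) i.
Let in_time s := 0 <= s /\ (s%:E < T)%E.

Lemma timer_ge0 s i : in_time s -> 0 <= t s 0 i.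
Proof. by move=> [s0 sT]; have [+ _ _] := t_sol; exact. Qed.

Lemma hit_vector_bounds s i : in_time s -> 0 <= h s 0 i < 1.
Proof. by move=> sT; rewrite mxE hit_probability_bounds// timer_ge0. Qed.

Lemma hit_vector_cube s : in_time s -> cube (h s).
Proof. by move=> sT i; have := hit_vector_bounds i sT; lra. Qed.

Lemma near_in_time s : 0 < s -> (s%:E < T)%E -> \forall r \near s, in_time r.
Proof.
move=> s0 sT.
have near0 : \forall r \near s, 0 < r by exact: lt_nbhsr.
suff nearT : \forall r \near s, (r%:E < T)%E.
  by near=> r; split; [apply: ltW|]; near: r.
case: T sT => [b| |]; rewrite ?ltNge ?leNye//.
- by rewrite -ltNge lte_fin => sb; near=> r; rewrite lte_fin; near: r; exact: lt_nbhsl.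
- by move=> _; near=> r; rewrite ltry.
Unshelve. all: by end_near. Qed.

Section OdeInstant.
Variable s : R.
Hypotheses (s0 : 0 < s) (sT : (s%:E < T)%E).
Hypothesis t_ode : satisfies_ode_at U C B k c lambda t s.

Let s_time : in_time s. Proof. by split; [exact: ltW|]. Qed.

(* At [t_i = 0] the differentiable function [t_i] has an interior minimum, so
   its derivative vanishes and the max in the dynamics is inactive. *)
Lemma velocity_cases i :
  0 < t s 0 i /\ velocity s i = k i * marginal (h s) i \/
  [/\ t s 0 i = 0, velocity s i = 0 & marginal (h s) i <= 0].
Proof.
have := t_ode i; rewrite -/(velocity s i).
have -> : velocity s i = if 0 < t s 0 i then k i * marginal (h s) i
    else Num.max 0 (k i * marginal (h s) i) by [].
case: ifPn => [ti0 _|]; first by left.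
rewrite -leNgt => ti0 dti; right.
have {ti0} ti0 : t s 0 i = 0 by apply/eqP; rewrite eq_le ti0 timer_ge0.
set g := k i * _ in dti *.
suff g0 : Num.max 0 g <= 0.
  have M0 : Num.max 0 g = 0 by apply/eqP; rewrite eq_le g0 le_max lexx.
  split => //; rewrite -(pmulr_rle0 _ (k_gt0 i)).
  by apply: le_trans g0; rewrite le_max lexx orbT.
rewrite leNgt; apply/negP => l0; set l := Num.max 0 g in dti l0.
(* With tolerance [l / 2], going back in time by a small [r] would bring the timer to at most
   [- l * r / 2], below 0. *)
have l20 : 0 < l / 2 by rewrite divr_gt0.
have [d d0 H] := is_derive_has_slope dti l20.
have /nbhs_ballP[d' /= d'0 H'] := near_in_time s0 sT.
pose r := Num.min d d' / 2.
have r0 : 0 < r by rewrite divr_gt0// lt_min d0.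
have rd : r < d.
  have : Num.min d d' <= d by rewrite ge_min lexx.
  by rewrite /r; lra.
have rd' : r < d'.
  have : Num.min d d' <= d' by rewrite ge_min lexx orbT.
  by rewrite /r; lra.
have := H (s - r) I; rewrite (_ : s - r - s = - r); last by ring.
rewrite normrN gtr0_norm// => /(_ rd); rewrite ti0 ler_norml => /andP[_].
have : 0 <= t (s - r) 0 i.
  apply: timer_ge0; apply: H'; rewrite /ball/= (_ : s - (s - r) = r); last by ring.
  by rewrite gtr0_norm.
have : 0 < l * r by rewrite mulr_gt0.
lra.
Qed.

Let rate i := hit_rate c (lambda i) (t s 0 i).

Lemma is_derive_hit_vector i :
  is_derive s 1 (fun r => h r 0 i) (rate i * velocity s i).
Proof.
rewrite (_ : (fun _ => _) = hit_probability c (lambda i) \o (fun r => t r 0 i)).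
  apply: is_derive1_comp; last exact: t_ode.
  by apply: is_derive_hit_probability => //; exact: timer_ge0.
by apply/funext => r; rewrite mxE.
Qed.

Lemma is_derive_lyapunov :
  is_derive s 1 V (lyapunov_slope (t s)).
Proof.
have dUh i : is_derive s 1 (fun r => U i (h r 0 i))
    (dU i (h s 0 i) * (rate i * velocity s i)).
  (* A zero timer puts the hit probability at the endpoint 0, where [U i] has only a one-sided
     derivative. *)
  apply: (has_slope_comp (derive_on_has_slope _) (is_derive_hit_vector i)).
    by apply: U_diff; rewrite /= in_itv/=; exact: hit_vector_cube.
  apply: filterS (near_in_time s0 sT) => r rT.
  by rewrite /= in_itv/=; exact: hit_vector_cube.
have dsum := is_derive_fsum is_derive_hit_vector.
have dC : is_derive s 1 (fun r => C (1 * (\sum_i h r 0 i) + - B))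
    (derive1 C (1 * (\sum_i h s 0 i) + - B) *
      (1 * \sum_i rate i * velocity s i)).
  apply: (@is_derive1_comp R C (fun r => 1 * (\sum_i h r 0 i) + - B) s).
    exact: C_is_derive.
  exact: (@is_derive1_comp R (fun x => 1 * x + - B) (fun r => \sum_i h r 0 i) s
     _ _ (is_derive_affine 1 (- B) _)).
have dV := is_deriveB (is_derive_cst (net_utility U C B hstar) s 1)
  (is_deriveB (is_derive_fsum dUh) dC).
have -> : V = cst (net_utility U C B hstar) -
    ((fun r => \sum_i U i (h r 0 i)) - (fun r => C (1 * (\sum_i h r 0 i) + - B))).
  by apply/funext => r; rewrite /V /lyapunov /net_utility !fctE mul1r.
apply: is_derive_eq; rewrite sub0r !mul1r mulr_sumr -sumrB; congr (- _).
by apply: eq_bigr => i _; rewrite /marginal mulrBl.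
Qed.

(** A positive timer contributes the square of the marginal times positive factors; a zero timer
    does not move. *)
Lemma dissipation_ge0 i : 0 <= marginal (h s) i * (rate i * velocity s i).
Proof.
have [[ti ->]|[_ -> _]] := velocity_cases i; last by rewrite !mulr0.
have /andP[r0 _] := hit_rate_bounds c (lambda_gt0 i) (ltW ti).
rewrite mulrCA mulr_ge0 ?(ltW r0)// mulrCA mulr_ge0 ?(ltW (k_gt0 i))//.
by rewrite -expr2 sqr_ge0.
Qed.

Lemma lyapunov_slope_le0 : lyapunov_slope (t s) <= 0.
Proof. by rewrite oppr_le0; apply: sumr_ge0 => i _; exact: dissipation_ge0. Qed.

(** If the slope were 0, each term would vanish: m_i = 0 at positive timers, while at zero timers
    h_i = 0 and m_i <= 0. The supporting hyperplane then gives V <= 0, which forces [h s] to be the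
    maximizer. *)
Lemma lyapunov_slope_lt0 : h s <> hstar ->
  lyapunov_slope (t s) < 0.
Proof.
move=> hs; rewrite lt_neqAle lyapunov_slope_le0 andbT.
apply/negP; rewrite oppr_eq0 psumr_eq0; last by move=> i _; exact: dissipation_ge0.
move=> /allP D0; apply: hs; apply: lyapunov_eq0; first exact: hit_vector_cube.
apply: (le_trans (lyapunov_le_marginal (hit_vector_cube s_time))).
rewrite -oppr_ge0 -sumrN; apply: sumr_ge0 => i _.
have /andP[hi0 _] := hstar_interior i.
have [[ti vi]|[ti _ mi]] := velocity_cases i; last first.
  have -> : h s 0 i = 0.
    by rewrite mxE ti hit_probability0.
  by rewrite subr0 -mulNr mulr_ge0 ?oppr_ge0// ltW.
have := D0 i (mem_index_enum i); rewrite /= -/(velocity s i) vi.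
have /andP[r0 _] := hit_rate_bounds c (lambda_gt0 i) (ltW ti).
rewrite !mulf_eq0 (gt_eqF r0) (gt_eqF (k_gt0 i)) /= orbb => /eqP ->.
by rewrite mul0r oppr0.
Qed.

End OdeInstant.
End Trajectory.

(** * Decay of V and convergence of global trajectories *)

Section GlobalTrajectory.
Variable t : R -> 'rV[R]_N.
Hypothesis t_sol : solution U C B k c lambda +oo%E t.

Let h s := hit_vector c lambda (t s).
Let V s := lyapunov U C B hstar (h s).

Let in_time (s : R) : 0 <= s -> 0 <= s /\ (s%:E < +oo)%E.
Proof. by move=> s0; split => //; exact: ltry. Qed.

Definition timer_potential (s : R) :=
  \sum_i (hit_primitive c (lambda i) (t s 0 i) - hstar 0 i * t s 0 i) / k i.

Lemma ae_ode (a b : R) (P : R -> Prop) : 0 <= a ->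
  (forall s, 0 < s -> s < b -> satisfies_ode_at U C B k c lambda t s -> P s) ->
  {ae (@lebesgue_measure R), forall s, a < s < b -> P s}.
Proof.
move=> a0 HP; have [_ _ t_ae] := t_sol.
apply: negligibleS t_ae => s /= nP ts; apply: nP => /andP[as_ sb].
have s0 : 0 < s := le_lt_trans a0 as_.
by apply: HP => //; apply: ts => //; exact: ltry.
Qed.

Lemma timer_ac b i : 0 <= b -> absolutely_continuous_on 0 b (fun s => t s 0 i).
Proof. by move=> b0; have [_ + _] := t_sol; apply => //; exact: ltry. Qed.

Lemma hit_ac b i : 0 <= b -> absolutely_continuous_on 0 b (fun s => h s 0 i).
Proof.
move=> b0; apply: (absolutely_continuous_dominated (ltW (lambda_gt0 i)) (timer_ac i b0)).
move=> u v u0 uv vb; rewrite !mxE.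
apply: (derive_bounded_lipschitz (df := hit_rate c (lambda i))).
- by move=> x x0; exact: is_derive_hit_probability.
- move=> x x0; have /andP[r0 rl] := hit_rate_bounds c (lambda_gt0 i) x0.
  by rewrite gtr0_norm.
- exact: (timer_ge0 t_sol i (in_time u0)).
- exact: (timer_ge0 t_sol i (in_time (le_trans u0 uv))).
Qed.

Lemma lyapunov_ac b : 0 <= b -> absolutely_continuous_on 0 b V.
Proof.
move=> b0.
have hb s i : 0 <= s -> 0 <= h s 0 i <= 1.
  by move=> s0; exact: (hit_vector_cube t_sol (in_time s0)).
have Uac i : absolutely_continuous_on 0 b (fun s => - U i (h s 0 i)).
  have K0 : 0 <= `|dU i 0| + `|dU i 1| by rewrite addr_ge0.
  apply: (absolutely_continuous_dominated K0 (hit_ac i b0)) => u v u0 uv vb.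
  rewrite -opprD normrN; apply: (tangent_lipschitz (@U_tangent i)).
    exact: hb.
  exact/hb/(le_trans u0).
have Sac : absolutely_continuous_on 0 b (fun s => \sum_i h s 0 i).
  by apply: absolutely_continuous_sum => i; exact: hit_ac.
pose d := derive1 C.
(* The argument of [C] stays between [- B] and [N - B], so the slopes at these two ends give a
   Lipschitz constant. *)
have K0 : 0 <= `|- d (- B)| + `|- d (N%:R - B)| by rewrite addr_ge0.
have Cac : absolutely_continuous_on 0 b (fun s => C (\sum_i h s 0 i - B)).
  apply: (absolutely_continuous_dominated K0 Sac) => u v u0 uv vb.
  have hS s : 0 <= s -> - B <= \sum_i h s 0 i - B <= N%:R - B.
    move=> s0; rewrite lerBrDr addNr lerD2r sumr_ge0/=; last first.
      by move=> i _; have /andP[] := hb s i s0.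
    rewrite -[N in N%:R]card_ord -sumr_const; apply: ler_sum => i _.
    by have /andP[] := hb s i s0.
  have := @tangent_lipschitz R (\- C) (\- d) (- B) (N%:R - B) _ _ _
    (hS u u0) (hS v (le_trans u0 uv)).
  rewrite /= -opprD normrN (_ : _ - B - _ = \sum_i h v 0 i - \sum_i h u 0 i).
    apply=> x y _ _; have := @convex_tangent R C x y C_convex (@C_derivable _).
    by rewrite /d; lra.
  by ring.
have := absolutely_continuousD (absolutely_continuous_sum Uac) Cac.
have id0 := absolutely_continuous_id 0 b.
move=> VC; apply: (absolutely_continuous_dominated ler01 VC) => u v _ _ _.
rewrite mul1r /V /lyapunov /net_utility !sumrN.
by rewrite le_eqVlt; apply/orP; left; apply/eqP; congr (`|_|); ring.
Qed.

Lemma lyapunov_nonincr a b : 0 <= a -> a <= b -> V b <= V a.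
Proof.
move=> a0 ab; apply: absolutely_continuous_nonincr => //.
  move=> e /(lyapunov_ac (le_trans a0 ab))[d d0 H]; exists d => // n u v uv.
  by apply: H => l; have [? [? ?]] := uv l; split => //; exact: le_trans a0 _.
apply: ae_ode => // s s0 _ sode; exists (lyapunov_slope (t s)).
  exact: (lyapunov_slope_le0 t_sol s0 (ltry _) sode).
exact: (is_derive_lyapunov t_sol s0 (ltry _) sode).
Qed.

Lemma timer_potential_ac b : 0 <= b -> absolutely_continuous_on 0 b timer_potential.
Proof.
move=> b0; apply: absolutely_continuous_sum => i.
have k0 : 0 <= (k i)^-1 by rewrite invr_ge0 ltW.
apply: (absolutely_continuous_dominated k0 (timer_ac i b0)) => u v u0 uv vb.
rewrite -mulrBl normrM mulrC (ger0_norm k0) ler_wpM2l//.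
(* The Lipschitz constant is 1, since the derivative in the timer is a difference of two numbers in
   [0, 1]. *)
rewrite -[leRHS]mul1r.
pose p := hstar 0 i.
apply: (@derive_bounded_lipschitz R (fun x => hit_primitive c (lambda i) x - p * x)
  (fun x => hit_probability c (lambda i) x - p)).
- move=> x x0.
  have dP := is_derive_hit_primitive c (lambda_gt0 i) x0.
  have dl := is_derive_affine p 0 x.
  rewrite (_ : (fun _ => _) = hit_primitive c (lambda i) - (fun y => p * y + 0)).
    exact: is_deriveB.
  by apply/funext => y; rewrite !fctE addr0.
- move=> x x0; have := hit_probability_bounds c (lambda_gt0 i) x0.
  have := hstar_interior i; rewrite -/p ler_norml; lra.
- exact: (timer_ge0 t_sol i (in_time u0)).
- exact: (timer_ge0 t_sol i (in_time (le_trans u0 uv))).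
Qed.

Lemma timer_potential_derive s : 0 < s ->
  satisfies_ode_at U C B k c lambda t s ->
  exists2 l, l <= - V s & is_derive s 1 timer_potential l.
Proof.
move=> s0 sode; pose v i := timer_velocity U C B k c lambda (t s) i.
exists (\sum_i (k i)^-1 * ((h s 0 i - hstar 0 i) * v i)).
  rewrite lerNr; apply: (le_trans (lyapunov_le_marginal
    (hit_vector_cube t_sol (in_time (ltW s0))))).
  rewrite -sumrN; apply: ler_sum => i _; rewrite -/(h s).
  have [[_ vi]|[ti vi mi]] := velocity_cases t_sol s0 (ltry _) sode i.
    rewrite /v vi -/(h s) mulrCA mulKf ?gt_eqF//.
    by rewrite -mulNr opprB mulrC.
  (* A resting zero timer contributes 0 to the derivative, whereas its term in the bound for V is
     m_i h*_i <= 0; the inequality survives. *)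
  rewrite /v vi !mulr0 oppr0 -/(h s).
  have -> : h s 0 i = 0.
    by rewrite mxE ti hit_probability0.
  by rewrite subr0 mulr_le0_ge0//; have := hstar_interior i; lra.
apply: is_derive_fsum => i; pose p := hstar 0 i.
have ts0 := timer_ge0 t_sol i (in_time (ltW s0)).
have dP := is_derive_hit_primitive c (lambda_gt0 i) ts0.
have dl := is_derive_affine p 0 (t s 0 i).
have dcomp := is_derive1_comp (is_deriveB dP dl) (sode i).
have := is_deriveZ (k i)^-1 dcomp.
rewrite (_ : _ \*: _ = fun r =>
  (hit_primitive c (lambda i) (t r 0 i) - hstar 0 i * t r 0 i) / k i); last first.
  by apply/funext => r; rewrite !fctE/= /GRing.scale/= addr0 mulrC.
by move=> /is_derive_eq; apply; rewrite /GRing.scale/= mxE.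
Qed.

Lemma lyapunov_decay : exists K, forall b, 0 < b -> b * V b <= K.
Proof.
have /choice[m mP] i : exists m, forall x, 0 <= x ->
    m <= hit_primitive c (lambda i) x - hstar 0 i * x.
  exact: hit_primitive_ge.
exists (timer_potential 0 - \sum_i m i / k i) => b b0.
(* Freezing V at the final time [b] makes the added term linear; before [b] its slope [V b] is at
   most [V s]. *)
pose g s := timer_potential s + V b * s.
have : g b <= g 0.
  apply: absolutely_continuous_nonincr; first exact: ltW.
    apply: absolutely_continuousD; first exact/timer_potential_ac/ltW.
    apply: (@absolutely_continuous_dominated _ _ _ `|V b| _ id) => //.
      exact: absolutely_continuous_id.
    by move=> u v _ _ _; rewrite -mulrBr normrM.
  apply: ae_ode => // s s0 sb sode.
  have [l lV dl] := timer_potential_derive s0 sode.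
  exists (l + V b).
    by have := lyapunov_nonincr (ltW s0) (ltW sb); lra.
  have dlin := is_derive_affine (V b) 0 s.
  rewrite (_ : g = timer_potential + (fun y => V b * y + 0)).
    exact: is_deriveD.
  by apply/funext => r; rewrite !fctE addr0.
rewrite /g mulr0 addr0 mulrC.
have : \sum_i m i / k i <= timer_potential b.
  apply: ler_sum => i _; rewrite ler_pM2r ?invr_gt0//; apply: mP.
  exact: (timer_ge0 t_sol i (in_time (ltW b0))).
lra.
Qed.

Lemma hit_vector_cvg : h s @[s --> +oo] --> hstar.
Proof.
have [K HK] := lyapunov_decay.
apply/cvg_ballP => e e0.
suff : \forall s \near +oo, forall i, `|hstar 0 i - h s 0 i| < e.
  by apply: filterS => s H; split => // i j; rewrite (ord1 i); exact: H.
apply: filter_forall => i.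
have [m m0 H] := lyapunov_separated i e0.
near=> s.
have s0 : 0 < s by near: s; exact: (nbhs_pinfty_gt (num_real _)).
(* Beyond [K / m] the decay bound reads [s * V s <= K < s * m], hence [V s < m]. *)
have sK : K / m < s by near: s; exact: (nbhs_pinfty_gt (num_real _)).
apply: H; first exact: (hit_vector_cube t_sol (in_time (ltW s0))).
rewrite -(ltr_pM2l s0); apply: le_lt_trans (HK s s0) _.
by rewrite -ltr_pdivrMr.
Unshelve. all: by end_near. Qed.

End GlobalTrajectory.

End Model.

Theorem mainTheorem5 (R : realType) (N : nat) (B : R) (lambda k : 'I_N -> R)
    (U : 'I_N -> R -> R) (C : R -> R) (hstar : 'rV[R]_N) (c : ttl_cache)
    (N_ge1 : (1 <= N)%N) (B_gt0 : 0 < B)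
    (lambda_gt0 : forall i, 0 < lambda i) (k_gt0 : forall i, 0 < k i)
    (U_increasing : forall i, {in `[0, 1] &, {homo U i : x y / x <= y}})
    (U_C1 : forall i, continuously_derivable_on `[0, 1]%classic (U i))
    (U_concave : forall i, strictly_concave_on `[0, 1]%classic (U i))
    (C_convex : convex_function [set: R^o] C)
    (C_increasing : {homo C : x y / x <= y})
    (C_derivable : forall x, derivable C x 1)
    (hstar_cube : cube hstar)
    (hstar_max : forall h, cube h -> net_utility U C B h <= net_utility U C B hstar)
    (hstar_interior : forall i, 0 < hstar 0 i < 1) :
  (* V is nonnegative and vanishes exactly at h* *)
  (forall h, cube h ->
     0 <= lyapunov U C B hstar h /\
     (lyapunov U C B hstar h = 0 <-> h = hstar)) /\
  (* V is strictly decreasing along solutions away from h* *)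
  (forall (T : \bar R) (t : R -> 'rV[R]_N),
     solution U C B k c lambda T t ->
     forall s : R, 0 < s -> (s%:E < T)%E ->
     satisfies_ode_at U C B k c lambda t s ->
     hit_vector c lambda (t s) <> hstar ->
     let V := fun r : R => lyapunov U C B hstar (hit_vector c lambda (t r)) in
     derivable V s 1 /\ derive1 V s < 0) /\
  (* global convergence *)
  (forall t : R -> 'rV[R]_N,
     solution U C B k c lambda +oo%E t ->
     hit_vector c lambda (t s) @[s --> +oo] --> hstar).
Proof.
have U_diff i x : `[0, 1]%classic x -> derivable_on `[0, 1]%classic (U i) x.
  by have [+ _] := U_C1 i; exact.
split; [|split].
- move=> h hc; split; first exact: lyapunov_ge0.
  split=> [V0|->]; last by rewrite /lyapunov subrr.
  apply: (lyapunov_eq0 U_diff U_concave C_convex C_derivable hstar_cube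
    hstar_max hstar_interior hc).
  by rewrite V0.
- move=> T t t_sol s s0 sT sode hs V.
  have dV : is_derive s 1 V (lyapunov_slope B lambda k U C c (t s)).
    exact: (is_derive_lyapunov hstar lambda_gt0 U_diff C_derivable t_sol).
  split; first by have [] := dV.
  rewrite derive1E derive_val.
  exact: (lyapunov_slope_lt0 lambda_gt0 k_gt0 U_diff U_concave C_convex
    C_derivable hstar_cube hstar_max hstar_interior t_sol s0 sT sode hs).
- move=> t t_sol.
  exact: (hit_vector_cvg lambda_gt0 k_gt0 U_diff U_concave C_convex
    C_derivable hstar_cube hstar_max hstar_interior t_sol).
Qed.
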